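(* Let $\phi$ be a probability-generating weight function supplied by efficient classical and coherent sampling circuits, let $\mathbf G=(G_1,\dots,G_m)$ be a temporal graph on $n$ labeled vertices with snapshot-bit access, and suppose a number $K\ge F_\phi(\mathbf G)$ is supplied. For $1/n\le\varepsilon\le1/4$ and $0<\delta<1/3$, there is a randomized classical algorithm that uses $$\widetilde O\!\left(m\min\left\{n^2,\frac{K+n}{\varepsilon^2}\right\}\right)$$ snapshot queries and returns a number $\widehat F$ with $|\widehat F-F_\phi(\mathbf G)|\le\varepsilon n$ with probability at least $1-\delta$.
   Context: Temporal graph and access: $\mathbf G=(G_1,\dots,G_m)$ are simple undirected graphs on the common vertex set $\{1,\dots,n\}$. A (classical) snapshot query $(t,u,v)$ returns the bit $\mathbf 1_{\{u,v\}\in E(G_t)}$; queries may be adaptive and randomized. Query complexity counts only these queries; no other access to $\mathbf G$ is given. The algorithm is given $n,m,\phi,\varepsilon,\delta$ and $K$. Statistic: regard the $G_t$ as one-dimensional simplicial complexes. The intersection zigzag is $\mathcal Z(\mathbf G): G_1\leftarrow G_1\cap G_2\rightarrow G_2\leftarrow\cdots\rightarrow G_m$ (inclusions), with snapshot nodes $G_1,\dots,G_m$. Its degree-one homology over a fixed arbitrary field decomposes into interval modules $b$ (bars); the snapshot lifetime $\ell_b\in\{0,\dots,m\}$ is the number of snapshot nodes in the support of $b$. A probability-generating weight function is $\phi(x)=\mathbb E[x^R]=\sum_{r=1}^{r_{\max}}a_rx^r$ for an input-independent random variable $R$ on $\{1,\dots,r_{\max}\}$ with $a_r=\Pr[R=r]$,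 and $F_\phi(\mathbf G)=\sum_b\phi(\ell_b/m)$. Samplers for $R$ make no snapshot queries. $\widetilde O$ hides factors polylogarithmic in $n,m,1/\varepsilon,1/\delta$. *)

(* Defs.v *)
From HB Require Import structures.
From mathcomp Require Import all_boot all_order all_algebra.
From mathcomp Require Import zify reals exp.

Set Implicit Arguments.
Unset Strict Implicit.
Unset Printing Implicit Defensive.

Import Order.TTheory GRing.Theory Num.Theory.
Local Open Scope ring_scope.

(** * Temporal graphs *)

Record sgraph (n : nat) := SGraph {
  adj :> rel 'I_n;
  adj_sym : symmetric adj;
  adj_irr : irreflexive adj }.

(* Vertices and snapshots are numbered from 0. *)
Definition temporal_graph (n m : nat) := 'I_m -> sgraph n.

(** * Degree-one simplicial homology of a graph *)

Section Homology.
Variables (k : fieldType) (n : nat).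
Implicit Type e : rel 'I_n.

(* A 1-chain is a matrix c whose entry c u v, for an edge {u, v} with u < v, is
   the coefficient of the oriented simplex [u, v]; all other entries vanish. *)
Definition chains1 e : {vspace 'M[k]_n} :=
  <<[seq delta_mx uv.1 uv.2 |
      uv <- enum [pred uv : 'I_n * 'I_n | (uv.1 < uv.2)%N && e uv.1 uv.2]]>>%VS.

(* d[u, v] = [v] - [u] *)
Definition boundary1 (c : 'M[k]_n) : 'rV[k]_n :=
  \row_w (\sum_u c u w - \sum_v c w v).

Lemma boundary1_is_linear : linear boundary1.
Proof.
move=> a c d; apply/rowP => w; rewrite !mxE mulrBr !mulr_sumr.
under eq_bigr do rewrite !mxE.
under [X in _ - X = _]eq_bigr do rewrite !mxE.
by rewrite !big_split /= opprD addrACA.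
Qed.

HB.instance Definition _ :=
  GRing.isLinear.Build k 'M[k]_n 'rV[k]_n *:%R boundary1 boundary1_is_linear.

Definition cycles1 e : {vspace 'M[k]_n} :=
  (lker (linfun boundary1) :&: chains1 e)%VS.

(* There are no 2-simplices, hence no nonzero boundaries in degree one. *)
Definition H1 e : lmodType k := subvs_of (cycles1 e).

(* The map induced by an inclusion of graphs e <= e'; see H1_inclE.  (It is a
   meaningless linear map when e is not a subgraph of e'.) *)
Definition H1_incl e e' : {linear H1 e -> H1 e'} :=
  (vsproj (cycles1 e') \o vsval : {linear subvs_of (cycles1 e) -> subvs_of (cycles1 e')}).

Lemma cycles1S e e' : subrel e e' -> (cycles1 e <= cycles1 e')%VS.
Proof.
move=> le_ee'; apply: capvS => //; apply: sub_span => c /mapP[uv].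
rewrite mem_enum => /andP[lt_uv e_uv] ->; apply: (map_f (fun uv => delta_mx uv.1 uv.2)).
by rewrite mem_enum inE lt_uv le_ee'.
Qed.

Lemma H1_inclE e e' (z : H1 e) : subrel e e' -> vsval (H1_incl e e' z) = vsval z.
Proof.
by move=> le_ee'; rewrite /H1_incl /= vsprojK // (subvP (cycles1S le_ee')) ?subvsP.
Qed.

End Homology.

(** * Zigzag modules *)

(* The nodes of G_1 <- G_1 /\ G_2 -> G_2 <- ... -> G_m are numbered 0, ..., 2m - 2
   from left to right: node 2t is snapshot t, node 2t + 1 is the intersection of
   snapshots t and t + 1. *)
Definition node (m : nat) := 'I_(m.*2.-1).

Definition arrow (m : nat) (i j : node m) : bool :=
  odd i && ((i == j.+1 :> nat) || (j == i.+1 :> nat)).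

Section Zigzag.
Variables (k : fieldType) (m : nat).

Record zigzag := Zigzag {
  zz_space :> node m -> lmodType k;
  zz_map : forall i j, arrow i j -> {linear zz_space i -> zz_space j} }.

Definition zz_morphism (M N : zigzag) (f : forall i, {linear M i -> N i}) : Prop :=
  forall (i j : node m) (ij : arrow i j) (x : M i),
    f j (zz_map M ij x) = zz_map N ij (f i x).

(* M is the direct sum of the family S: the morphisms iota b are the components
   of an isomorphism from the direct sum of the S b onto M. *)
Definition zz_direct_sum (M : zigzag) (I : finType) (S : I -> zigzag) : Prop :=
  exists iota : forall (b : I) (i : node m), {linear S b i -> M i},
    (forall b, zz_morphism (iota b)) /\
    forall (i : node m) (x : M i),
      exists! y : (forall b, S b i), x = \sum_b iota b i (y b).

(* The pair (p, q), with p <= q, stands for a bar with support {p, ..., q}. *)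
Definition bar := (node m * node m)%type.

Definition in_bar (b : bar) (i : node m) : bool := (b.1 <= i <= b.2)%N.

(* Dimension 1 on the support and 0 elsewhere; pid_mx 1 is the identity between
   two nodes of the support and is necessarily zero otherwise. *)
Definition interval_module (b : bar) : zigzag :=
  @Zigzag (fun i => 'rV[k]_(in_bar b i))
    (fun i j _ => mulmxr (pid_mx 1 : 'M[k]_(in_bar b i, in_bar b j))).

Definition interval_decomposition (M : zigzag) (B : seq bar) : Prop :=
  all (fun b : bar => b.1 <= b.2)%N B /\
  zz_direct_sum M (fun x : 'I_(size B) => interval_module (tnth (in_tuple B) x)).

(* Number of snapshot nodes in the support of b. *)
Definition lifetime (b : bar) : nat := #|[set t : 'I_m | b.1 <= t.*2 <= b.2]%N|.

End Zigzag.

Section IntersectionZigzag.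
Variables (k : fieldType) (n m : nat) (G : temporal_graph n m).

(* i./2 = uphalf i = t if i = 2t, while i./2 = t and uphalf i = t + 1 if i = 2t + 1. *)
Definition node_graph (i : node m) : rel 'I_n :=
  fun u v => [forall t : 'I_m, (i./2 <= t <= uphalf i)%N ==> G t u v].

Lemma arrow_subgraph (i j : node m) :
  arrow i j -> subrel (node_graph i) (node_graph j).
Proof.
rewrite /arrow => ij u v /forallP Gi; apply/forallP => t; apply/implyP => jt.
by apply: (implyP (Gi t)); lia.
Qed.

Definition H1_zigzag : zigzag k m :=
  @Zigzag k m (fun i => H1 k (node_graph i))
    (fun i j _ => H1_incl k (node_graph i) (node_graph j)).

Definition barcode (B : seq (bar m)) : Prop := interval_decomposition H1_zigzag B.

End IntersectionZigzag.

(** * Probability-generating weight functions and the statistic *)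

(* rv_law r = Pr[R = r]; only the values at r = 1, ..., rv_max matter. *)
Record weight (R : realType) := Weight {
  rv_max : nat;
  rv_law : nat -> R;
  rv_law_ge0 : forall r, 0 <= rv_law r;
  rv_law_sum1 : \sum_(1 <= r < rv_max.+1) rv_law r = 1 }.

Definition weight_fun (R : realType) (phi : weight R) (x : R) : R :=
  \sum_(1 <= r < (rv_max phi).+1) rv_law phi r * x ^+ r.

Definition statistic (R : realType) (phi : weight R) (m : nat) (B : seq (bar m)) : R :=
  \sum_(b <- B) weight_fun phi ((lifetime b)%:R / m%:R).

(** * Randomized snapshot-query algorithms *)

(* A run returns a number, or asks for the bit of {u, v} in snapshot t, or draws
   a uniform element of 'I_N.+1, or calls the sampler of the random variable R. *)
Inductive algorithm (R : realType) (n m : nat) :=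
| Return of R
| Query of 'I_m & 'I_n & 'I_n & (bool -> algorithm R n m)
| Uniform (N : nat) of ('I_N.+1 -> algorithm R n m)
| SampleR of (nat -> algorithm R n m).

Section Semantics.
Variables (R : realType) (n m : nat) (phi : weight R) (G : temporal_graph n m).

(* Largest number of snapshot queries over all random outcomes, on input G. *)
Fixpoint query_cost (A : algorithm R n m) : nat :=
  match A with
  | Return _ => 0%N
  | Query t u v A' => (query_cost (A' (G t u v))).+1
  | Uniform N A' => (\max_(i < N.+1) query_cost (A' i))%N
  | SampleR A' => (\max_(1 <= r < (rv_max phi).+1) query_cost (A' r))%N
  end.

(* Probability, on input G, that the returned number satisfies P. *)
Fixpoint output_prob (P : pred R) (A : algorithm R n m) : R :=
  match A with
  | Return x => (P x)%:R
  | Query t u v A' => output_prob P (A' (G t u v))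
  | Uniform N A' => \sum_(i < N.+1) N.+1%:R^-1 * output_prob P (A' i)
  | SampleR A' =>
      \sum_(1 <= r < (rv_max phi).+1) rv_law phi r * output_prob P (A' r)
  end.

End Semantics.

(** * Polylogarithmic factors *)

Definition polylog (R : realType) (c n m : nat) (eps delta : R) : R :=
  (1 + ln n%:R + ln m%:R + ln eps^-1 + ln delta^-1) ^+ c.

(* Main.v *)
Require Import Defs.
From mathcomp Require Import all_boot all_order all_algebra.
From mathcomp Require Import reals exp.
From mathcomp Require Import zify ring lra boolp sequences.

Import Order.TTheory GRing.Theory Num.Theory.
Local Open Scope ring_scope.

(* All maps of the zigzag H_1(G) are inclusions of cycle spaces, so every bar starts
   and ends at a snapshot, and the bars containing the snapshots s, ..., t are counted
   by the cycle rank of the intersection G_s /\ ... /\ G_t. Since (l_b / m)^r is the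
   probability that r uniform snapshots lie in b, the statistic is the expectation of
   the cycle rank |E| - n + c of the intersection over the interval spanned by R uniform
   snapshots.

   If n^2 <= (K + n) / eps^2, the algorithm reads the whole input. Otherwise it
   estimates E|E| and E c = sum_v E[1 / |C(v)|] separately. For the edges it samples
   (K + n) / eps^2 pairs of vertices, up to a logarithmic factor; as
   E|E| <= F + n <= K + n, the variance of the hits is small enough for Chernoff's
   bound. For the components it samples N ~ 1 / eps^2 vertices and tests, by a truncated
   graph search, whether |C(v)| <= N / i in the i-th sample: the expected number of
   positive answers is N E[1 / |C(v)|] up to 1, and the harmonic sum of the thresholds
   N / i bounds the number of expanded vertices by N (1 + ln N). *)

(** * The dimension of the cycle space *)

(** The hypothesis is linear independence of the family [g] over [P]. It is transported to the tuple
    that enumerates [P], where freeness is equality of the dimension and the length. *)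
Lemma dim_span_image (k : fieldType) (vT : vectType k) (I : finType)
    (P : {pred I}) (g : I -> vT) :
  (forall a : I -> k, \sum_(b in P) a b *: g b = 0 -> {in P, forall b, a b = 0}) ->
  \dim <<[seq g b | b in P]>>%VS = #|P|.
Proof.
move=> gfree; pose X := image_tuple g P.
have Xfree : free X.
  apply/freeP => c c0 i.
  have Pi := enum_valP i.
  pose a b := c (enum_rank_in Pi b).
  suff : a (enum_val i) = 0 by rewrite /a enum_valK_in.
  apply: gfree => //; rewrite big_enum_val -[RHS]c0; apply: eq_bigr => j _.
  by rewrite /a enum_valK_in nth_image.
by move: Xfree; rewrite /free => /eqP; rewrite size_tuple.
Qed.

Section CycleRank.
Variables (k : fieldType) (n : nat) (e : rel 'I_n).
Hypothesis e_sym : symmetric e.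

Let edges : {pred 'I_n * 'I_n} := [pred uv : 'I_n * 'I_n | (uv.1 < uv.2)%N && e uv.1 uv.2].

Lemma dim_chains1 : \dim (chains1 k e) = #|edges|.
Proof.
apply: dim_span_image => a a0 [u v] uv_e.
have := congr1 (fun c : 'M_n => c u v) a0.
rewrite summxE (bigD1 (u, v)) //= !mxE !eqxx mulr1 big1 ?addr0 // => -[x y] /=.
case/andP=> _ /negPf xy; rewrite !mxE [u == x]eq_sym [v == y]eq_sym.
by move: xy; rewrite xpair_eqE => ->; rewrite mulr0.
Qed.

Let d (v : 'I_n) : 'rV[k]_n := delta_mx 0 v.
Let W := (linfun (@boundary1 k n) @: chains1 k e)%VS.

Lemma boundary1_delta u v : boundary1 (delta_mx u v) = d v - d u :> 'rV[k]_n.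
Proof.
apply/rowP => w; rewrite !mxE eqxx /=; congr (_ - _).
- rewrite (bigD1 u) //= !mxE eqxx big1 ?addr0 // => x /negPf xu.
  by rewrite mxE xu.
- rewrite (bigD1 v) //= !mxE eqxx andbT big1 ?addr0 // => x /negPf xu.
  by rewrite mxE xu andbF.
Qed.

Lemma edge_boundary u v : e u v -> d v - d u \in W.
Proof.
wlog lt_uv : u v / (u < v)%N => [hw uv|uv].
  case: (ltngtP u v) => [/hw -> //|/hw|/val_inj uv1].
    by rewrite e_sym => /(_ uv); rewrite -memvN opprB.
  by rewrite -uv1 subrr mem0v.
rewrite -boundary1_delta -[boundary1 _](lfunE (boundary1 (n:=n))).
apply: memv_img; apply: memv_span; apply/mapP; exists (u, v) => //.
by rewrite mem_enum inE lt_uv.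
Qed.

Lemma connect_boundary u v : connect e u v -> d v - d u \in W.
Proof.
case/connectP => p; elim: p u => [|w p IH] u /= => [_ ->|/andP[uw wp] vp].
  by rewrite subrr mem0v.
rewrite -(subrK (d w) (d v)) -addrA rpredD ?(IH w) //.
exact: edge_boundary.
Qed.

Let rt := fingraph.root e.
(** Right multiplication by [P] collapses each vertex to the root of its component. It plays the
    part of the projection onto degree-zero homology. *)
Let P : 'M[k]_n := \matrix_v d (rt v).
Let pi0 := mulmxr P : {linear 'rV[k]_n -> 'rV[k]_n}.

Lemma pi0E x : pi0 x = \sum_v x 0 v *: d (rt v).
Proof. by rewrite /pi0 /= mulmx_sum_row; apply: eq_bigr => v _; rewrite rowK. Qed.

Lemma pi0d v : pi0 (d v) = d (rt v).
Proof. by rewrite /pi0 /= -rowE rowK. Qed.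

Let e_csym : connect_sym e := sym_connect_sym e_sym.

(** The ends of an edge have the same root, so boundaries are killed. Conversely, a vector [x] of
    the kernel equals [x - pi0 x], a combination of differences between vertices and their roots,
    and each difference bounds a path. *)
Lemma boundaries_lker : W = lker (linfun pi0).
Proof.
apply/eqP; rewrite eqEsubv; apply/andP; split.
  rewrite /W limg_span; apply/span_subvP => x /mapP[c /mapP[[u v]]].
  rewrite mem_enum inE /= => /andP[_ uv] -> ->.
  have -> : linfun (@boundary1 k n) (delta_mx u v) = d v - d u.
    by rewrite lfunE; apply: boundary1_delta.
  rewrite memv_ker lfunE linearB !pi0d subr_eq0.
  by rewrite /rt; have := connect1 uv; rewrite -(root_connect e_csym) => /eqP->.
apply/subvP => x; rewrite memv_ker lfunE => /eqP x0.
have -> : x = \sum_v x 0 v *: (d v - d (rt v)).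
  transitivity (x - pi0 x); first by rewrite [pi0 x]x0 subr0.
  rewrite pi0E {1}[x]row_sum_delta -sumrB.
  by apply: eq_bigr => v _; rewrite scalerBr.
apply: memv_suml => v _; apply: memvZ; rewrite -memvN opprB.
exact/connect_boundary/connect_root.
Qed.

Lemma dim_limg_pi0 : \dim (limg (linfun pi0)) = n_comp e predT.
Proof.
have -> : limg (linfun pi0) = <<[seq d v | v in roots e]>>%VS.
  apply/eqP; rewrite eqEsubv; apply/andP; split.
    apply/subvP => _ /memv_imgP[x _ ->]; rewrite lfunE pi0E.
    apply: memv_suml => v _; apply: memvZ; apply: memv_span.
    by apply: image_f; apply: roots_root.
  apply/span_subvP => _ /imageP[v /eqP rv ->].
  apply/memv_imgP; exists (d v); rewrite ?memvf // lfunE pi0d.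
  by rewrite /rt rv.
rewrite dim_span_image; first by apply: eq_card => v; rewrite !inE andbT.
move=> a a0 v rv; have := congr1 (fun c : 'rV_n => c 0 v) a0.
rewrite summxE (bigD1 v) //= !mxE !eqxx mulr1 big1 ?addr0 // => x /andP[_ /negPf xv].
by rewrite !mxE [v == x]eq_sym xv mulr0.
Qed.

(** Rank-nullity is applied twice: to the boundary map on the chains, and to [pi0] on the whole
    space, whose kernel is the image of the first map. *)
Lemma cycle_rank : (\dim (cycles1 k e) + n = #|edges| + n_comp e predT)%N.
Proof.
have h1 := limg_ker_dim (linfun (@boundary1 k n)) (chains1 k e).
have h2 := limg_ker_dim (linfun pi0) fullv.
move: h1 h2; rewrite capfv dim_limg_pi0 -boundaries_lker dim_chains1 /W /cycles1 capvC.
by rewrite dimvf /dim /= mul1n => h1 h2; rewrite -h1 -addnA h2.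
Qed.

(** A component with s vertices contributes s summands equal to 1 / s. *)
Lemma n_comp_sum (R : numFieldType) :
  (n_comp e predT)%:R = \sum_v (#|connect e v|%:R)^-1 :> R.
Proof.
have -> : n_comp e predT = #|roots e| by apply: eq_card => v; rewrite !inE andbT.
rewrite (partition_big rt (mem (roots e))) /=; last by move=> v _; apply: roots_root.
rewrite -sum1_card natr_sum; apply: eq_bigr => r rr.
under eq_bigr => v /eqP rv.
  have -> : #|connect e v| = #|connect e r|.
    apply: eq_card => w; rewrite !inE; apply: (same_connect e_csym).
    by rewrite -rv; apply: connect_root.
  over.
have -> : \sum_(v | rt v == r) (#|connect e r|%:R)^-1 =
          \sum_(v in connect e r) (#|connect e r|%:R)^-1 :> R.
  apply: eq_bigl => v; rewrite inE -(root_connect e_csym) (eqP rr).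
  by rewrite eq_sym.
rewrite sumr_const -(mulr_natl _^-1) divff // pnatr_eq0 -lt0n.
by apply/card_gt0P; exists r; apply: connect0.
Qed.
End CycleRank.

(** * Bars and intersections of snapshots *)

(** The space of an interval module at a node consists of rows whose length is the boolean [in_bar]:
    a line on the support and zero elsewhere. This lemma and the next one give coordinates there. *)
Lemma rV_bool_scale (k : fieldType) (c : bool) (y : 'rV[k]_c) :
  y = (\sum_j y 0 j) *: const_mx 1.
Proof.
apply/rowP; case: c y => y j; last by case: j.
by rewrite !mxE big_ord1 mulr1 (ord1 j).
Qed.

Lemma rV_false0 (k : fieldType) (c : bool) (y : 'rV[k]_c) : c = false -> y = 0.
Proof. by move=> c0; apply/rowP; case: c c0 y => // _ y []. Qed.

Section Bars.
Variables (k : fieldType) (n m : nat) (G : temporal_graph n m) (B : seq (bar m)).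
Let bar_of (b : 'I_(size B)) : bar m := tnth (in_tuple B) b.

(** As all maps are inclusions inside one matrix space, the generator of a bar is the same matrix
    [g b] at every node of its support. The bars through a node thus index a basis of its cycle
    space. By injectivity no bar dies along an arrow, which is the last clause. *)
Lemma barcode_basis : barcode k G B ->
  exists g : 'I_(size B) -> 'M[k]_n,
  [/\ forall b i, in_bar (bar_of b) i -> g b \in cycles1 k (node_graph G i),
      forall i (a : 'I_(size B) -> k), \sum_(b | in_bar (bar_of b) i) a b *: g b = 0 ->
        forall b, in_bar (bar_of b) i -> a b = 0,
      forall i x, x \in cycles1 k (node_graph G i) ->
        exists a : 'I_(size B) -> k, x = \sum_(b | in_bar (bar_of b) i) a b *: g b
    & forall b (i j : node m), arrow i j ->
        in_bar (bar_of b) i -> in_bar (bar_of b) j].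
Proof.
case=> /allP B_le [iota [iotaM iotaU]].
have ble b : ((bar_of b).1 <= (bar_of b).2)%N by apply: B_le; apply: mem_tnth.
pose S b := interval_module k (bar_of b).
pose one b i : S b i := const_mx 1.
pose gen b i : 'M[k]_n := vsval (iota b i (one b i)).
(* The zero family and the family with the single entry [z] both decompose 0, so uniqueness
   identifies them. *)
have iota_inj b i (z : S b i) : iota b i z = 0 -> z = 0.
  move=> z0; have [y [_ yU]] := iotaU i 0.
  have e0 : y = (fun b' => 0 : S b' i).
    by apply: yU; rewrite big1 // => b' _; apply: raddf0.
  have e1 : y = dfwith (fun b' => 0 : S b' i) z.
    apply: yU; rewrite (bigD1 b) //= dfwith_in z0 add0r big1 // => b' bb'.
    by rewrite dfwith_out 1?eq_sym //; apply: raddf0.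
  by rewrite -(dfwith_in (fun b' => 0 : S b' i) z) -e1 e0.
have one_eq0 b i : one b i = 0 -> in_bar (bar_of b) i = false.
  rewrite /one /S /=; case: in_bar => // /rowP /(_ ord0); rewrite !mxE => /eqP.
  by rewrite oner_eq0.
have zz_inj (i j : node m) (ij : arrow i j) (x : H1_zigzag k G i) :
    vsval (zz_map (H1_zigzag k G) ij x) = vsval x.
  by apply: H1_inclE; apply: arrow_subgraph.
have gen_arrow b (i j : node m) : arrow i j -> in_bar (bar_of b) i -> in_bar (bar_of b) j ->
    gen b i = gen b j.
  move=> ij bi bj; rewrite /gen.
  transitivity (vsval (zz_map (H1_zigzag k G) ij (iota b i (one b i)))).
    exact/esym/zz_inj.
  rewrite -iotaM; congr (vsval (iota b j _)).
  rewrite /= /one /=; move: bi bj; rewrite /S /=.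
  case: (in_bar _ i) => // _; case: (in_bar _ j) => // _.
  apply/rowP => l; rewrite !mxE big_ord1 !mxE (ord1 l) /=.
  by rewrite mulr1.
(* If the bar ended at [i], its structure map would send the generator to 0, although the inclusion
   preserves the underlying matrix. *)
have arrow_in b (i j : node m) : arrow i j -> in_bar (bar_of b) i -> in_bar (bar_of b) j.
  move=> ij bi; apply: contraT => /negbTE bj.
  suff : one b i = 0 by move/one_eq0; rewrite bi.
  apply: (iota_inj b i); apply: val_inj.
  transitivity (vsval (zz_map (H1_zigzag k G) ij (iota b i (one b i)))).
    exact/esym/zz_inj.
  rewrite -iotaM.
  have -> : zz_map (S b) ij (one b i) = 0.
    exact: rV_false0 bj.
  by rewrite [iota b j 0]raddf0.
pose g b := gen b (bar_of b).1.
(* Induction from the left end of the bar: of two neighbouring nodes the odd one is the source of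
   the arrow, so the direction depends on parity. *)
have genE b i : in_bar (bar_of b) i -> gen b i = g b.
  have [N leN] := ubnP (i - (bar_of b).1); elim: N i leN => // N IH i leN bi.
  have [lti|] := ltnP (bar_of b).1 i; last first.
    move=> lei; congr gen; apply: val_inj; move: bi; rewrite /in_bar /=; lia.
  have i'P : (i.-1 < m.*2.-1)%N by have := ltn_ord i; lia.
  have bi' : in_bar (bar_of b) (Ordinal i'P) by move: bi; rewrite /in_bar /=; lia.
  rewrite -(IH (Ordinal i'P)) //=; last lia.
  have [oi|oi] := boolP (odd i).
    by apply: gen_arrow => //; rewrite /arrow oi /=; lia.
  by apply/esym/gen_arrow => //; rewrite /arrow /=; lia.
have iotaE i (y : forall b, S b i) :
    vsval (\sum_b iota b i (y b)) = \sum_(b | in_bar (bar_of b) i) (\sum_j y b 0 j) *: g b.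
  rewrite raddf_sum /= [LHS](bigID (fun b => in_bar (bar_of b) i)) /= [X in _ + X]big1 ?addr0.
    apply: eq_bigr => b bi; rewrite -(genE b i bi) /gen -linearZ -linearZ /=.
    by congr (vsval (iota b i _)); apply: rV_bool_scale.
  move=> b /negbTE bi.
  have -> : y b = 0.
    exact: rV_false0 bi.
  by rewrite [iota b i 0]raddf0.
have sum1 b i c : in_bar (bar_of b) i ->
    \sum_j (c *: one b i : 'rV_(in_bar (bar_of b) i)) 0 j = c :> k.
  rewrite /one /S /=; case: in_bar => // _; by rewrite big_ord1 !mxE mulr1.
exists g; split => //.
- by move=> b i bi; rewrite -(genE b i bi); apply: subvsP.
- move=> i a a0; pose y b := a b *: one b i.
  have [z [_ zU]] := iotaU i 0.
  have zy : z = y.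
    apply: zU; apply: val_inj; rewrite /= iotaE -[LHS]a0.
    by apply: eq_bigr => b bi; rewrite /y (sum1 b i (a b) bi).
  have z0 : z = (fun b => 0 : S b i).
    by apply: zU; rewrite big1 // => b' _; apply: raddf0.
  move=> b bi; rewrite -(sum1 b i (a b) bi) -/(y b) -zy z0.
  by rewrite big1 // => j _; rewrite mxE.
- move=> i x xi; have [y [yx _]] := iotaU i (vsproj _ x).
  exists (fun b => \sum_j y b 0 j); rewrite -iotaE -yx.
  by rewrite vsprojK.
Qed.

(** * Cycles of intersections of consecutive snapshots *)

Definition common (s t : nat) : rel 'I_n :=
  fun u v => [forall i : 'I_m, (s <= i <= t)%N ==> G i u v].

Lemma common_sym s t : symmetric (common s t).
Proof. by move=> u v; apply: eq_forallb => i; rewrite adj_sym. Qed.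

Lemma common_irr s t : (s <= t)%N -> (t < m)%N -> irreflexive (common s t).
Proof.
move=> st tm u; apply/negbTE/negP => /forallP /(_ (Ordinal tm)).
by rewrite adj_irr /= st leqnn.
Qed.

Lemma chains1_entry0 (e : rel 'I_n) (c : 'M[k]_n) (u v : 'I_n) :
  c \in chains1 k e -> ~~ ((u < v)%N && e u v) -> c u v = 0.
Proof.
move=> ce uv; rewrite (coord_span (X := in_tuple _) ce) summxE big1 // => i _.
rewrite mxE; set X := [seq _ | _ <- _].
have /mapP[[x y]] : X`_i \in X by apply: mem_nth.
rewrite mem_enum => xy ->; rewrite mxE; case: eqVneq => [ux|]; last by rewrite mulr0.
case: eqVneq => [vy|]; last by rewrite mulr0.
by move: uv; rewrite ux vy; move: xy; rewrite inE /= => ->.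
Qed.

Lemma chains1P (e : rel 'I_n) (c : 'M[k]_n) :
  (forall u v : 'I_n, ~~ ((u < v)%N && e u v) -> c u v = 0) -> c \in chains1 k e.
Proof.
move=> c0; rewrite [c]matrix_sum_delta; apply: memv_suml => u _; apply: memv_suml => v _.
have [uv|/c0 ->] := boolP ((u < v)%N && e u v); last by rewrite scale0r mem0v.
apply: memvZ; apply: memv_span; apply/mapP; exists (u, v) => //.
by rewrite mem_enum inE.
Qed.

(** The boundary does not depend on the graph, and being a chain is a condition on each entry
    separately. A cycle of all the nodes in the range is therefore supported on the edges common to
    all the snapshots. *)
Lemma cycles1_common s t x : (s <= t)%N -> (t < m)%N ->
  reflect (forall i : node m, (s.*2 <= i <= t.*2)%N -> x \in cycles1 k (node_graph G i))
          (x \in cycles1 k (common s t)).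
Proof.
move=> st tm; apply: (iffP idP) => [xc i /andP[si it]|xi].
  apply: subvP x xc; apply: cycles1S => u v /forallP uv; apply/forallP => j.
  by apply/implyP => /andP[ij ji]; apply: (implyP (uv j)); lia.
have ns : (s.*2 < m.*2.-1)%N by lia.
have := xi (Ordinal ns); rewrite /= leqnn leq_double st => /(_ isT).
rewrite !memv_cap => /andP[-> _] /=.
apply: chains1P => u v; rewrite negb_and => /orP[uv|].
  have := xi (Ordinal ns); rewrite /= leqnn leq_double st => /(_ isT).
  rewrite memv_cap => /andP[_ /chains1_entry0 -> //]; by rewrite negb_and uv.
rewrite negb_forall => /existsP[j]; rewrite negb_imply => /andP[sjt juv].
have nj : (j.*2 < m.*2.-1)%N by have := ltn_ord j; lia.
have /xi : (s.*2 <= Ordinal nj <= t.*2)%N by rewrite /= !leq_double.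
rewrite memv_cap => /andP[_ /chains1_entry0 -> //].
rewrite negb_and; apply/orP; right; apply: contra juv => /forallP/(_ j).
by rewrite /= doubleK uphalf_double leqnn.
Qed.

(** The matrices [g b], for the bars that contain all nodes from [s.*2] to [t.*2], form a basis of
    the common cycle space. *)
Lemma bars_containing s t : barcode k G B -> (s <= t)%N -> (t < m)%N ->
  count (fun b : bar m => (b.1 <= s.*2)%N && (t.*2 <= b.2)%N) B =
  \dim (cycles1 k (common s t)).
Proof.
move=> /barcode_basis[g [g_in g_free g_span g_arrow]] st tm.
pose F j b := ((bar_of b).1 <= s.*2)%N && (j <= (bar_of b).2)%N.
have ns : (s.*2 < m.*2.-1)%N by lia.
have FI b : F t.*2 b -> in_bar (bar_of b) (Ordinal ns).
  by rewrite /F /in_bar /=; lia.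
have -> : cycles1 k (common s t) = <<[seq g b | b in F t.*2]>>%VS.
  apply/eqP; rewrite eqEsubv; apply/andP; split; last first.
    apply/span_subvP => _ /imageP[b bF ->]; apply/cycles1_common => // i sit.
    by apply: g_in; move: bF; rewrite unfold_in /F /in_bar; lia.
  apply/subvP => x /cycles1_common - /(_ st tm) xi.
  have [a ->] : exists a : 'I_(size B) -> k, x = \sum_(b | F t.*2 b) a b *: g b.
    (* Walk from node [s.*2] to the right, discarding the bars that end on the way. Leaving an odd
       node discards none, since bars persist along the arrow to the next snapshot. *)
    suff aux d : (s.*2 + d <= t.*2)%N ->
        exists a : 'I_(size B) -> k, x = \sum_(b | F (s.*2 + d)%N b) a b *: g b.
      by have := aux (t.*2 - s.*2)%N; rewrite subnKC ?leq_double // => /(_ (leqnn _)).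
    elim: d => [_|d IH dt].
      have [|a ax] := g_span (Ordinal ns) x; first by apply: xi; rewrite /= leqnn leq_double.
      by exists a; rewrite ax; apply: eq_bigl => b; rewrite /F /in_bar /= addn0.
    have [|a ax] := IH; first lia.
    have nj : (s.*2 + d < m.*2.-1)%N by lia.
    have nj1 : (s.*2 + d.+1 < m.*2.-1)%N by lia.
    have [od|od] := boolP (odd (s.*2 + d)).
      exists a; rewrite ax; apply: eq_bigl => b; rewrite /F.
      apply/idP/idP => /andP[b1 b2]; rewrite b1 /=; last lia.
      have /andP[] // : in_bar (bar_of b) (Ordinal nj1).
      apply: (g_arrow b (Ordinal nj)); first by rewrite /arrow /= od; lia.
      by rewrite /in_bar /=; lia.
    have [|a' ax'] := g_span (Ordinal nj1) x; first by apply: xi => /=; lia.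
    have in1 b : in_bar (bar_of b) (Ordinal nj1) -> in_bar (bar_of b) (Ordinal nj).
      by apply: g_arrow; rewrite /arrow /=; lia.
    (* Leaving a snapshot, the bars at the next node all pass through the current one. Both
       expansions of [x] thus use the free family of the current node, and their difference [c]
       vanishes; so does [a] on the bars that end here. *)
    pose c b := (if F (s.*2 + d)%N b then a b else 0) -
                (if in_bar (bar_of b) (Ordinal nj1) then a' b else 0).
    have c0 b : in_bar (bar_of b) (Ordinal nj) -> c b = 0.
      apply: g_free; under eq_bigr do rewrite scalerBl.
      rewrite sumrB; apply/eqP; rewrite subr_eq0; apply/eqP; transitivity x.
        rewrite ax [RHS]big_mkcond [LHS]big_mkcond /=; apply: eq_bigr => b' _.
        have [bF|_] := boolP (F _ b'); last by rewrite scale0r if_same.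
        by rewrite ifT //; move: bF; rewrite /F /in_bar /=; lia.
      rewrite ax' [RHS]big_mkcond [LHS]big_mkcond /=; apply: eq_bigr => b' _.
      case: ifP => [b1|_]; first by rewrite in1.
      by case: ifP; rewrite ?scale0r.
    exists a; rewrite ax [RHS]big_mkcond [LHS]big_mkcond /=; apply: eq_bigr => b' _.
    case: ifP => [b1|b1]; case: ifP => // b2; last by move: b1 b2; rewrite /F; lia.
    have := c0 b'; rewrite /c b1.
    have -> : in_bar (bar_of b') (Ordinal nj1) = false by move: b1 b2; rewrite /F /in_bar /=; lia.
    rewrite subr0 => ->; first by rewrite scale0r.
    by move: b1; rewrite /F /in_bar /=; lia.
  by apply: memv_suml => b bF; apply: memvZ; apply: memv_span; apply: image_f.
rewrite dim_span_image; last first.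
  move=> a a0 b bF.
  have := g_free (Ordinal ns) (fun b => if F t.*2 b then a b else 0) _ b (FI b bF).
  rewrite ifT //; apply; rewrite -[RHS]a0 [RHS]big_mkcond [LHS]big_mkcond /=.
  apply: eq_bigr => b' _; rewrite -[b' \in _]/(F t.*2 b').
  have [bF'|_] := boolP (F _ b'); last by rewrite scale0r if_same.
  by rewrite FI.
by rewrite -sum1_count -sum1_card big_tnth.
Qed.

End Bars.

(** * Chernoff's bound *)

Section Chernoff.
Variable R : realType.
Implicit Types (p : nat -> R) (h : nat -> R).

(* Expectation of [h (acc + X_1 + ... + X_N)] for independent Bernoulli
   variables [X_i] of parameter [p i]. *)
Fixpoint bernoulli_sum p N acc h : R :=
  if N is N'.+1 then
    p N * bernoulli_sum p N' acc.+1 h + (1 - p N) * bernoulli_sum p N' acc h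
  else h acc.

Let mean p N := \sum_(i < N) p i.+1.

Lemma le_bernoulli_sum p N acc h1 h2 :
  (forall i, 0 <= p i <= 1) -> (forall a, h1 a <= h2 a) ->
  bernoulli_sum p N acc h1 <= bernoulli_sum p N acc h2.
Proof.
move=> p01 h12; elim: N acc => [|N IH] acc //=.
have /andP[p0 p1] := p01 N.+1.
by rewrite lerD // ler_wpM2l // subr_ge0.
Qed.

Lemma bernoulli_sumD p N acc h1 h2 :
  bernoulli_sum p N acc (fun a => h1 a + h2 a) =
  bernoulli_sum p N acc h1 + bernoulli_sum p N acc h2.
Proof. by elim: N acc => [|N IH] acc //=; rewrite !IH; ring. Qed.

Lemma bernoulli_sumZ p N acc c h :
  bernoulli_sum p N acc (fun a => c * h a) = c * bernoulli_sum p N acc h.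
Proof. by elim: N acc => [|N IH] acc //=; rewrite !IH; ring. Qed.

Lemma bernoulli_sum_cst p N acc c : bernoulli_sum p N acc (fun=> c) = c.
Proof. by elim: N acc => [|N IH] acc //=; rewrite !IH; ring. Qed.

(** Each factor of the moment generating function is [1 + (expR l - 1) * p i], at most the
    exponential of [(expR l - 1) * p i]. *)
Lemma bernoulli_sum_mgf p N acc l : (forall i, 0 <= p i <= 1) ->
  bernoulli_sum p N acc (fun a => expR (l * a%:R)) <=
  expR (l * acc%:R + (expR l - 1) * mean p N).
Proof.
move=> p01; elim: N acc => [|N IH] acc /=; first by rewrite /mean big_ord0 mulr0 addr0.
have /andP[p0 p1] := p01 N.+1.
set X := (expR l - 1) * mean p N.
apply: (@le_trans _ _ (p N.+1 * expR (l * acc.+1%:R + X)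
                       + (1 - p N.+1) * expR (l * acc%:R + X))).
  by rewrite lerD // ler_wpM2l ?IH // subr_ge0.
have -> : l * acc.+1%:R + X = l + (l * acc%:R + X) by rewrite -natr1; ring.
rewrite [expR (l + _)]expRD /mean big_ord_recr /= -/(mean p N) mulrDr addrA -/X [leRHS]expRD.
set Y := expR (l * acc%:R + X).
rewrite (_ : _ + _ = Y * (1 + (expR l - 1) * p N.+1)); last by ring.
by rewrite ler_wpM2l ?expR_ge0 // expR_ge1Dx.
Qed.

(** From [1 - l <= expR (- l)] one gets [expR l <= (1 - l)^-1]; moreover (1 + l + 2 l^2)(1 - l) = 1
    + l^2 (1 - 2 l) is at least 1. *)
Lemma expR_le_quadratic (l : R) : `|l| <= 2^-1 -> expR l <= 1 + l + 2 * l ^+ 2.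
Proof.
rewrite ler_norml => /andP[l1 l2].
have h := expR_ge1Dx (- l).
rewrite -[expR l]invrK -expRN.
apply: (@le_trans _ _ (1 - l)^-1).
  by rewrite lef_pV2 ?posrE ?expR_gt0 //; lra.
rewrite -div1r ler_pdivrMr; last lra.
nra.
Qed.

(** Markov's inequality for the exponential moment; the sign of [l] selects the upper or the lower
    tail. *)
Lemma bernoulli_sum_tail p N l s (P : pred nat) : (forall i, 0 <= p i <= 1) ->
  `|l| <= 2^-1 -> (forall a, P a -> s <= l * (a%:R - mean p N)) ->
  bernoulli_sum p N 0 (fun a => (P a)%:R) <= expR (2 * l ^+ 2 * mean p N - s).
Proof.
move=> p01 l12 Pl; set mu := mean p N.
have mu0 : 0 <= mu by apply: sumr_ge0 => i _; case/andP: (p01 i.+1).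
apply: (@le_trans _ _ (expR (- l * mu - s) * expR (l * 0%:R + (expR l - 1) * mu))).
  apply: le_trans (ler_wpM2l (expR_ge0 _) (bernoulli_sum_mgf p N 0 l p01)).
  rewrite -bernoulli_sumZ; apply: le_bernoulli_sum => // a; rewrite -expRD.
  have [/Pl Pa|_] := boolP (P a); last exact: expR_ge0.
  by rewrite -[leLHS]expR0 ler_expR; move: Pa; rewrite -/mu; lra.
rewrite -expRD ler_expR mulr0 add0r.
have := ler_wpM2r mu0 (expR_le_quadratic _ l12).
lra.
Qed.

Lemma chernoff p N (t M : R) : (forall i, 0 <= p i <= 1) -> mean p N <= M ->
  0 < t -> t <= 2 * M ->
  bernoulli_sum p N 0 (fun a => (t <= `|a%:R - mean p N|)%R%:R) <=
  2 * expR (- (t ^+ 2 / (8 * M))).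
Proof.
move=> p01 muM t0 tM; set mu := mean p N.
have M0 : 0 < M by lra.
(* This [l] minimises 2 l^2 M - l t, with value - t^2 / (8 M); the bound [t <= 2 * M] gives
   [l <= 2^-1]. *)
set l := t / (4 * M); set s := t ^+ 2 / (4 * M).
have l0 : 0 < l by rewrite divr_gt0 //; lra.
have l12 : `|l| <= 2^-1.
  rewrite (ger0_norm (ltW l0)) /l ler_pdivrMr; last lra.
  by lra.
have st : s = l * t by rewrite /s /l expr2 mulrAC.
have b1 : 2 * l ^+ 2 * mu - s <= - (t ^+ 2 / (8 * M)).
  have -> : - (t ^+ 2 / (8 * M)) = 2 * l ^+ 2 * M - s by rewrite /l /s; field; lra.
  by rewrite lerD2r ler_wpM2l // mulr_ge0 // sqr_ge0.
apply: (@le_trans _ _ (bernoulli_sum p N 0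
   (fun a => (t <= a%:R - mu)%R%:R + (t <= mu - a%:R)%R%:R))).
  apply: le_bernoulli_sum => // a; rewrite -natrD ler_nat.
  have [ta|//] := boolP (t <= `|_|).
  rewrite -/mu; move: ta; have [?|?] := ger0P (a%:R - mu) => ta; first by rewrite ta.
  by rewrite opprB in ta; rewrite ta; case: (t <= _).
rewrite bernoulli_sumD mulrDl mul1r; apply: lerD.
  apply: le_trans (bernoulli_sum_tail _ _ l s _ p01 l12 _) _.
    by move=> a ta; rewrite st ler_wpM2l // ltW.
  by rewrite ler_expR.
apply: le_trans (bernoulli_sum_tail _ _ (- l) s _ p01 _ _) _.
- by rewrite normrN.
- by move=> a ta; rewrite mulNr -mulrN opprB st ler_wpM2l // ltW.
by rewrite ler_expR sqrrN.
Qed.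

End Chernoff.

(** * The statistic as an expected cycle rank *)

Section RandomInterval.
Variables (R : realType) (m : nat) (phi : weight R).
Implicit Types h : nat -> nat -> R.

(** Only the running minimum and maximum of the draws are kept; the recursion has the shape of
    [draw_times]. *)
Fixpoint avg_times r lo hi h : R :=
  if r is r'.+1 then
    \sum_(i < m.+1) m.+1%:R^-1 * avg_times r' (minn lo i) (maxn hi i) h
  else h lo hi.

(* Expectation of [h s t], where [s] and [t] are the minimum and the maximum of [r]
   independent uniform snapshots and [r] has law [rv_law phi]. *)
Definition avg_interval h : R :=
  \sum_(1 <= r < (rv_max phi).+1) rv_law phi r *
    \sum_(i < m.+1) m.+1%:R^-1 * avg_times r.-1 i i h.

Lemma uniform_cst N (c : R) : \sum_(i < N.+1) N.+1%:R^-1 * c = c.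
Proof.
by rewrite sumr_const card_ord -mulrnAl -[_ *+ _](mulr_natl _^-1) divff ?mul1r ?pnatr_eq0.
Qed.

Let le_avg_times r lo hi h1 h2 : (lo <= hi <= m)%N ->
  (forall s t, (s <= t <= m)%N -> h1 s t <= h2 s t) ->
  avg_times r lo hi h1 <= avg_times r lo hi h2.
Proof.
move=> lohi h12; elim: r lo hi lohi => [|r IH] lo hi lohi /=; first exact: h12.
apply: ler_sum => i _; apply: ler_wpM2l; first by rewrite invr_ge0.
by apply: IH; have := ltn_ord i; lia.
Qed.

Lemma le_avg_interval h1 h2 : (forall s t, (s <= t <= m)%N -> h1 s t <= h2 s t) ->
  avg_interval h1 <= avg_interval h2.
Proof.
move=> h12; apply: ler_sum => r _; apply: ler_wpM2l; first exact: rv_law_ge0.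
apply: ler_sum => i _; apply: ler_wpM2l; first by rewrite invr_ge0.
by apply: le_avg_times => //; rewrite leqnn -ltnS ltn_ord.
Qed.

Lemma eq_avg_interval h1 h2 : (forall s t, (s <= t <= m)%N -> h1 s t = h2 s t) ->
  avg_interval h1 = avg_interval h2.
Proof.
by move=> h12; apply/le_anti/andP; split; apply: le_avg_interval => s t st; rewrite h12.
Qed.

Let avg_times_lin r lo hi c h1 h2 :
  avg_times r lo hi (fun s t => c * h1 s t + h2 s t) =
  c * avg_times r lo hi h1 + avg_times r lo hi h2.
Proof.
elim: r lo hi => //= r IH lo hi; rewrite mulr_sumr -big_split /=.
by apply: eq_bigr => i _; rewrite IH mulrDr mulrCA.
Qed.

Lemma avg_interval_lin c h1 h2 :
  avg_interval (fun s t => c * h1 s t + h2 s t) = c * avg_interval h1 + avg_interval h2.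
Proof.
rewrite /avg_interval mulr_sumr -big_split /=; apply: eq_bigr => r _.
rewrite mulrCA -mulrDr; congr (_ * _); rewrite mulr_sumr -big_split /=.
by apply: eq_bigr => i _; rewrite avg_times_lin mulrDr mulrCA.
Qed.

Let avg_times_cst r lo hi c : avg_times r lo hi (fun _ _ => c) = c.
Proof.
elim: r lo hi => //= r IH lo hi; rewrite -[RHS](uniform_cst m).
by apply: eq_bigr => i _; rewrite IH.
Qed.

Lemma avg_interval_cst c : avg_interval (fun _ _ => c) = c.
Proof.
rewrite -[RHS]mul1r -(rv_law_sum1 phi) mulr_suml; apply: eq_bigr => r _.
congr (_ * _); rewrite -[RHS](uniform_cst m); apply: eq_bigr => i _.
by rewrite avg_times_cst.
Qed.

Lemma avg_intervalZ c h : avg_interval (fun s t => c * h s t) = c * avg_interval h.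
Proof.
rewrite -[RHS]addr0 -(avg_interval_cst 0) -avg_interval_lin.
by apply: eq_avg_interval => s t _; rewrite addr0.
Qed.

Lemma avg_intervalD h1 h2 :
  avg_interval (fun s t => h1 s t + h2 s t) = avg_interval h1 + avg_interval h2.
Proof.
rewrite -[avg_interval h1]mul1r -avg_interval_lin.
by apply: eq_avg_interval => s t _; rewrite mul1r.
Qed.

Lemma avg_interval_sum (I : Type) (r : seq I) (F : I -> nat -> nat -> R) :
  avg_interval (fun s t => \sum_(i <- r) F i s t) = \sum_(i <- r) avg_interval (F i).
Proof.
elim: r => [|i r IH].
  rewrite big_nil -[RHS](avg_interval_cst 0); apply: eq_avg_interval => s t _.
  exact: big_nil.
rewrite big_cons -IH -avg_intervalD; apply: eq_avg_interval => s t _.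
by rewrite big_cons.
Qed.

(** All draws lie in the bar exactly when their minimum and maximum do, and each hits it
    independently with probability l_b / m. *)
Lemma avg_interval_bar (b : bar m.+1) :
  avg_interval (fun s t => ((b.1 <= s.*2)%N && (t.*2 <= b.2)%N)%:R) =
  weight_fun phi ((lifetime b)%:R / m.+1%:R).
Proof.
set x := _ / _.
have hit : \sum_(i < m.+1) m.+1%:R^-1 * ((b.1 <= i.*2 <= b.2)%N)%:R = x.
  rewrite -mulr_sumr mulrC /x; congr (_ / _).
  by rewrite -natr_sum /lifetime -sum1_card big_mkcond /=; congr (_%:R);
    rewrite [RHS]big_mkcond; apply: eq_bigr => i _; rewrite inE; case: ifP.
have times r lo hi : (lo <= hi)%N ->
    avg_times r lo hi (fun s t => ((b.1 <= s.*2)%N && (t.*2 <= b.2)%N)%:R) =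
    ((b.1 <= lo.*2)%N && (hi.*2 <= b.2)%N)%:R * x ^+ r.
  elim: r lo hi => [|r IH] lo hi lohi /=; first by rewrite mulr1.
  rewrite exprS [x * _]mulrC mulrA -{2}hit mulr_sumr; apply: eq_bigr => i _.
  rewrite IH; last lia.
  have -> : (b.1 <= (minn lo i).*2)%N && ((maxn hi i).*2 <= b.2)%N =
            ((b.1 <= lo.*2)%N && (hi.*2 <= b.2)%N) && (b.1 <= i.*2 <= b.2)%N by lia.
  by rewrite -mulnb natrM; ring.
(* The first draw initialises both extremes, so [r.-1] draws remain; [r] is positive in the range of
   the sum. *)
rewrite /avg_interval /weight_fun big_nat [RHS]big_nat; apply: eq_bigr => r /andP[r0 _].
congr (_ * _); rewrite -[in RHS](prednK r0) exprS -{1}hit mulr_suml.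
by apply: eq_bigr => i _; rewrite times // mulrA.
Qed.

End RandomInterval.

(** * The cycle rank as a real number, and its average *)

Section Betti.
Variables (R : realType) (n : nat).

(* |E| - n + c: a vertex contributes to the number c of components the inverse of the
   size of its own. *)
Definition betti1 (e : rel 'I_n) : R :=
  (\sum_u \sum_v (e u v)%:R) / 2 - n%:R + \sum_v (#|connect e v|%:R)^-1.

Lemma dim_cycles1 (k : fieldType) (e : rel 'I_n) : symmetric e -> irreflexive e ->
  (\dim (cycles1 k e))%:R = betti1 e.
Proof.
move=> e_sym e_irr; have := congr1 (fun x => x%:R : R) (cycle_rank k _ _ e_sym).
rewrite !natrD (n_comp_sum _ _ e_sym) /betti1 => h.
suff -> : \sum_u \sum_v (e u v)%:R =
    2 * #|[pred uv : 'I_n * 'I_n | (uv.1 < uv.2)%N && e uv.1 uv.2]|%:R :> R by lra.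
have split u v : (e u v)%:R = ((u < v)%N && e u v)%:R + ((v < u)%N && e v u)%:R :> R.
  rewrite -natrD [e v u]e_sym; case: ltngtP => [_|_|/val_inj ->]; rewrite ?addn0 //.
  by rewrite e_irr.
under eq_bigr do under eq_bigr do rewrite split.
under eq_bigr do rewrite big_split /=.
rewrite big_split /= [X in _ + X]exchange_big /= -mulr2n mulr_natl; congr (_ *+ _).
rewrite pair_big /= -sum1_card natr_sum [RHS]big_mkcond /=.
by apply: eq_bigr => uv _; rewrite inE; case: (_ && _).
Qed.

(** Exchanging the sum over bars with the expectation leaves the number of bars that contain the
    random interval, which is the cycle rank of the intersection. *)
Lemma statistic_avg (k : fieldType) m (phi : weight R) (G : temporal_graph n m.+1)
    (B : seq (bar m.+1)) : barcode k G B ->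
  statistic phi B = avg_interval R m phi (fun s t => betti1 (common n m.+1 G s t)).
Proof.
move=> GB; rewrite /statistic; under eq_bigr do rewrite -avg_interval_bar.
rewrite -avg_interval_sum; apply: eq_avg_interval => s t /andP[st tm].
rewrite -(dim_cycles1 k); [|exact: common_sym|exact: common_irr].
rewrite -(bars_containing _ _ _ _ _ _ _ GB) //.
by rewrite -natr_sum -big_mkcond sum1_count.
Qed.
End Betti.

(** * The algorithms *)

Section Algorithms.
Variables (R : realType) (n m : nat) (phi : weight R).
Notation alg := (algorithm R n.+1 m.+1).
Notation prob G P A := (output_prob phi G P A).

(* Subroutines are in continuation-passing style, because an [algorithm] can only
   return a real number. *)
Fixpoint query_set (I : finType) (ask : I -> (bool -> alg) -> alg)
    (qs : seq I) (acc : {set I}) (k : {set I} -> alg) : alg :=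
  if qs is q :: qs' then
    ask q (fun b => query_set I ask qs' (if b then q |: acc else acc) k)
  else k acc.

(** The pair is read in every snapshot and the answers are restricted to [s], ..., [t] afterwards,
    so that the cost is [m.+1] for every interval. *)
Definition query_common s t (u v : 'I_n.+1) (k : bool -> alg) : alg :=
  query_set _ (fun i k' => Query i u v k') (enum 'I_m.+1) set0
    (fun S => k [forall i : 'I_m.+1, (s <= i <= t)%N ==> (i \in S)]).

Definition query_neighbors s t (u : 'I_n.+1) : ({set 'I_n.+1} -> alg) -> alg :=
  query_set _ (query_common s t u) (enum 'I_n.+1) set0.

(* [D] contains the expanded vertices, [S] the discovered ones. *)
Fixpoint explore f s t (D S : {set 'I_n.+1}) (k : bool -> alg) : alg :=
  if f is f'.+1 then
    if [pick u in S :\: D] is Some u then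
      query_neighbors s t u (fun N => explore f' s t (u |: D) (S :|: N) k)
    else k true
  else k (S \subset D).

Fixpoint draw_times r lo hi (k : nat -> nat -> alg) : alg :=
  if r is r'.+1 then Uniform (N := m) (fun i => draw_times r' (minn lo i) (maxn hi i) k)
  else k lo hi.

Definition draw_interval (k : nat -> nat -> alg) : alg :=
  SampleR (fun r => Uniform (N := m) (fun i => draw_times r.-1 i i k)).

Definition edge_test (k : bool -> alg) : alg :=
  draw_interval (fun s t => Uniform (N := n) (fun u => Uniform (N := n) (fun v =>
    query_common s t u v k))).

Definition component_test c (k : bool -> alg) : alg :=
  draw_interval (fun s t => Uniform (N := n) (fun v => explore c s t set0 [set v] k)).

Fixpoint count_tests N (test : nat -> (bool -> alg) -> alg) acc (k : nat -> alg) : alg :=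
  if N is N'.+1 then test N (fun b => count_tests N' test (b + acc)%N k) else k acc.

Definition query_all : ({set 'I_m.+1 * ('I_n.+1 * 'I_n.+1)} -> alg) -> alg :=
  query_set _ (fun q => Query q.1 q.2.1 q.2.2) (enum {: 'I_m.+1 * ('I_n.+1 * 'I_n.+1)}) set0.

Definition exact_algorithm : alg :=
  query_all (fun S => Return _ _ (avg_interval R m phi (fun s t =>
    betti1 R n.+1 (fun u v =>
      [forall i : 'I_m.+1, (s <= i <= t)%N ==> ((i, (u, v)) \in S)])))).

Definition estimate (Ne Nc a b : nat) : R :=
  n.+1%:R ^+ 2 / 2 * (a%:R / Ne%:R) - n.+1%:R + n.+1%:R * (b%:R / Nc%:R).

(* Among c = 1, ..., Nc a fraction close to 1 / |C(v)| satisfies |C(v)| <= Nc / c. *)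
Definition sampling_algorithm (Ne Nc : nat) : alg :=
  count_tests Ne (fun=> edge_test) 0 (fun a =>
    count_tests Nc (fun c => component_test (Nc %/ c)) 0 (fun b =>
      Return _ _ (estimate Ne Nc a b))).

(** * Cost and output distribution of the subroutines *)

Section Semantics.
Variable G : temporal_graph n.+1 m.+1.

(** Typically [A] is a deterministic subroutine in continuation-passing style and [A'] its
    continuation at the computed value. *)
Definition resolves c (A A' : alg) :=
  (query_cost phi G A <= c + query_cost phi G A')%N /\
  forall P, prob G P A = prob G P A'.

Lemma resolves_trans c1 c2 A1 A2 A3 :
  resolves c1 A1 A2 -> resolves c2 A2 A3 -> resolves (c1 + c2) A1 A3.
Proof. by move=> [h1 e1] [h2 e2]; split=> [|P]; [lia | rewrite e1 e2]. Qed.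

Lemma query_setE (I : finType) ask (p : I -> bool) c qs acc k :
  (forall i k, resolves c (ask i k) (k (p i))) ->
  resolves (size qs * c) (query_set I ask qs acc k) (k (acc :|: [set i in qs | p i])).
Proof.
move=> askp; elim: qs acc => [|q qs IH] acc /=.
  rewrite (_ : acc :|: _ = acc); first by split.
  by apply/setP => i; rewrite !inE orbF.
rewrite mulSn; apply: resolves_trans (askp q _) _.
rewrite (_ : acc :|: _ = (if p q then q |: acc else acc) :|: [set i in qs | p i]) //.
apply/setP => i; rewrite !inE; case: ifP => pq; rewrite ?inE.
  by case: (eqVneq i q) => [->|] /=; rewrite ?pq ?orbT.
by case: (eqVneq i q) => [->|] //=; rewrite pq !andbF.
Qed.

Lemma query_setTE (I : finType) ask (p : I -> bool) c k :
  (forall i k, resolves c (ask i k) (k (p i))) ->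
  resolves (#|I| * c) (query_set I ask (enum I) set0 k) (k [set i | p i]).
Proof.
move=> askp; have := query_setE I ask p c (enum I) set0 k askp.
rewrite -cardE set0U; congr (resolves _ _ (k _)).
by apply/setP => i; rewrite !inE mem_enum.
Qed.

Lemma query_commonE s t u v k :
  resolves m.+1 (query_common s t u v k) (k (common n.+1 m.+1 G s t u v)).
Proof.
have := query_setTE _ (fun i k' => Query i u v k') (fun i => G i u v) 1
  (fun S => k [forall i : 'I_m.+1, (s <= i <= t)%N ==> (i \in S)]).
rewrite card_ord muln1 => /(_ _)[//|].
rewrite (_ : [forall _, _] = common n.+1 m.+1 G s t u v) //.
by apply: eq_forallb => i; rewrite inE.
Qed.

Lemma query_neighborsE s t u k :
  resolves (n.+1 * m.+1) (query_neighbors s t u k)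
    (k [set v | common n.+1 m.+1 G s t u v]).
Proof.
rewrite -{1}(card_ord n.+1); apply: query_setTE => v k'; exact: query_commonE.
Qed.

(** Once every discovered vertex is expanded, [S] is closed under edges, hence it is the component,
    of size at most [f0]. If the fuel runs out earlier, [D] has [f0] vertices and the component is
    strictly larger. *)
Lemma exploreE f s t v (D S : {set 'I_n.+1}) k f0 :
  D \subset S -> v \in S -> S \subset connect (common n.+1 m.+1 G s t) v ->
  (forall u w, u \in D -> common n.+1 m.+1 G s t u w -> w \in S) ->
  (#|D| + f = f0)%N ->
  resolves (f * (n.+1 * m.+1)) (explore f s t D S k)
    (k (#|connect (common n.+1 m.+1 G s t) v| <= f0)%N).
Proof.
set e := common _ _ _ _ _.
have closed (D' S' : {set 'I_n.+1}) : S' \subset D' -> D' \subset S' -> v \in S' ->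
    (forall u w, u \in D' -> e u w -> w \in S') -> connect e v \subset S'.
  move=> SD DS vS DN; apply/subsetP => w /connectP[p]; elim: p v vS => [|x p IH] u uS /=.
    by move=> _ ->.
  by case/andP=> ux; apply: IH; apply: (DN u) => //; apply: (subsetP SD).
elim: f D S => [|f IH] D S DS vS SC DN Df /=.
  rewrite (_ : (_ <= f0)%N = (S \subset D)); first by split.
  rewrite -Df addn0; apply/idP/idP => [Cle|SD].
    have DC := subset_trans DS SC; apply: (subset_trans SC).
    by have [_ <-] := subset_leqif_card DC; rewrite eqn_leq Cle (subset_leq_card DC).
  by apply: subset_leq_card; apply: (subset_trans _ SD); apply: closed SD DS vS DN.
case: pickP => [u|none].
  rewrite !inE => /andP[uD uS]; rewrite mulSn.
  apply: resolves_trans (query_neighborsE _ _ _ _) _.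
  apply: IH.
  - apply/subsetP => w; rewrite !inE => /orP[/eqP ->|/(subsetP DS) ->]; by rewrite ?uS.
  - by rewrite inE vS.
  - apply/subsetP => w; rewrite inE => /orP[/(subsetP SC) //|].
    rewrite inE => uw; have uC := subsetP SC u uS.
    exact: connect_trans uC (connect1 uw).
  - move=> x w; rewrite !inE => /orP[/eqP -> uw|xD xw]; first by apply/orP; right.
    by rewrite (DN x w).
  by rewrite cardsU1 uD -Df; lia.
have SD : S \subset D.
  by apply/subsetP => w wS; move: (none w); rewrite !inE wS andbT => /negbFE.
rewrite (_ : (_ <= f0)%N = true); first by split=> //; lia.
rewrite -Df (leq_trans _ (leq_addr _ _)) //; apply: subset_leq_card.
by apply: (subset_trans _ SD); apply: closed SD DS vS DN.
Qed.

(** The answer is a Bernoulli bit of parameter [p], whatever is done with it later. Quantifying over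
    the continuation makes such tests stable under mixtures and composable in sequence. *)
Definition bernoulli_test c (p : R) (test : (bool -> alg) -> alg) :=
  [/\ 0 <= p <= 1,
    forall k d, (query_cost phi G (k true) <= d)%N -> (query_cost phi G (k false) <= d)%N ->
      (query_cost phi G (test k) <= c + d)%N
  & forall k P, prob G P (test k) = p * prob G P (k true) + (1 - p) * prob G P (k false)].

Lemma resolves_test c (b : bool) test :
  (forall k, resolves c (test k) (k b)) -> bernoulli_test c b%:R test.
Proof.
move=> tb; split=> [|k d kt kf|k P].
- by case: b {tb}; rewrite !lexx ?ler01.
- by have [h _] := tb k; apply: leq_trans h _; rewrite leq_add2l; case: b {tb}.
- by have [_ ->] := tb k; case: b {tb}; rewrite ?subrr ?subr0 ?mul0r ?mul1r ?addr0 ?add0r.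
Qed.

Lemma uniform_test N c (p : 'I_N.+1 -> R) (test : 'I_N.+1 -> (bool -> alg) -> alg) :
  (forall i, bernoulli_test c (p i) (test i)) ->
  bernoulli_test c (\sum_i N.+1%:R^-1 * p i) (fun k => Uniform (fun i => test i k)).
Proof.
move=> T; have p01 i : 0 <= p i <= 1 by case: (T i).
split=> [|k d kt kf|k P] /=.
- apply/andP; split.
    by apply: sumr_ge0 => i _; rewrite mulr_ge0 ?invr_ge0 //; case/andP: (p01 i).
  rewrite -[leRHS](uniform_cst R N); apply: ler_sum => i _.
  by rewrite ler_wpM2l ?invr_ge0 //; case/andP: (p01 i).
- by apply/bigmax_leqP => i _; case: (T i) => _ + _; apply.
- rewrite -[X in (X - _) * _](uniform_cst R N) -sumrB !mulr_suml -big_split /=.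
  by apply: eq_bigr => i _; case: (T i) => _ _ ->; ring.
Qed.

Lemma draw_times_test r lo hi c (p : nat -> nat -> R)
    (test : nat -> nat -> (bool -> alg) -> alg) :
  (lo <= hi <= m)%N ->
  (forall s t, (s <= t <= m)%N -> bernoulli_test c (p s t) (test s t)) ->
  bernoulli_test c (avg_times R m r lo hi p)
    (fun k => draw_times r lo hi (fun s t => test s t k)).
Proof.
move=> lohi T; elim: r lo hi lohi => [|r IH] lo hi lohi /=; first exact: T.
apply: (uniform_test m c _ (fun i k => draw_times r (minn lo i) (maxn hi i) (fun s t => test s t k))).
by move=> i; apply: IH; have := ltn_ord i; lia.
Qed.

Lemma draw_interval_test c (p : nat -> nat -> R)
    (test : nat -> nat -> (bool -> alg) -> alg) :
  (forall s t, (s <= t <= m)%N -> bernoulli_test c (p s t) (test s t)) ->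
  bernoulli_test c (avg_interval R m phi p)
    (fun k => draw_interval (fun s t => test s t k)).
Proof.
move=> T.
have U r : bernoulli_test c (\sum_(i < m.+1) m.+1%:R^-1 * avg_times R m r.-1 i i p)
    (fun k => Uniform (N := m) (fun i => draw_times r.-1 i i (fun s t => test s t k))).
  apply: (uniform_test m c _ (fun i k => draw_times r.-1 i i (fun s t => test s t k))) => i.
  by apply: draw_times_test => //; rewrite leqnn -ltnS ltn_ord.
split=> [|k d kt kf|k P] /=.
- apply/andP; split.
    by rewrite -(avg_interval_cst R m phi 0); apply: le_avg_interval => s t /T[/andP[]].
  by rewrite -[leRHS](avg_interval_cst R m phi 1); apply: le_avg_interval => s t /T[/andP[]].
- by apply/bigmax_leqP_seq => r _ _; case: (U r) => _ h _; apply: h.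
- rewrite -[X in (X - _) * _](rv_law_sum1 phi) /avg_interval -sumrB !mulr_suml -big_split /=.
  by apply: eq_bigr => r _; case: (U r) => _ _ /= ->; ring.
Qed.

Definition edge_prob : R := avg_interval R m phi (fun s t =>
  \sum_u n.+1%:R^-1 * (\sum_v n.+1%:R^-1 * (common n.+1 m.+1 G s t u v)%:R)).

Definition component_prob c : R := avg_interval R m phi (fun s t =>
  \sum_v n.+1%:R^-1 * ((#|connect (common n.+1 m.+1 G s t) v| <= c)%N)%:R).

Lemma edge_testP : bernoulli_test m.+1 edge_prob edge_test.
Proof.
apply: (draw_interval_test m.+1 _ (fun s t k => Uniform (fun u => Uniform (fun v =>
    query_common s t u v k)))) => s t st.
apply: (uniform_test n m.+1 _ (fun u k => Uniform (fun v => query_common s t u v k))) => u.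
apply: (uniform_test n m.+1 _ (fun v k => query_common s t u v k)) => v.
by apply: resolves_test => k; apply: query_commonE.
Qed.

Lemma component_testP c :
  bernoulli_test (c * (n.+1 * m.+1)) (component_prob c) (component_test c).
Proof.
apply: (draw_interval_test _ _ (fun s t k =>
    Uniform (fun v => explore c s t set0 [set v] k))) => s t st.
apply: (uniform_test n _ _ (fun v k => explore c s t set0 [set v] k)) => v.
apply: resolves_test => k; apply: exploreE.
- exact: sub0set.
- by rewrite inE.
- by apply/subsetP => w; rewrite inE => /eqP ->; apply: connect0.
- by move=> u w; rewrite inE.
- by rewrite cards0.
Qed.

Lemma count_testsP N test acc (c : nat -> nat) (p : nat -> R) :
  (forall i, bernoulli_test (c i) (p i) (test i)) ->
  (forall k d, (forall a, (query_cost phi G (k a) <= d)%N) ->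
    (query_cost phi G (count_tests N test acc k) <= \sum_(i < N) c i.+1 + d)%N) /\
  (forall k P, prob G P (count_tests N test acc k) =
    bernoulli_sum R p N acc (fun a => prob G P (k a))).
Proof.
move=> T; elim: N acc => [|N IH] acc /=.
  by split=> // k d kd; rewrite big_ord0 add0n.
have [_ Tc Tp] := T N.+1.
split=> [k d kd|k P].
  rewrite big_ord_recr /= [(_ + c _)%N]addnC -addnA.
  apply: Tc; first by case: (IH (true + acc)%N) => h _; apply: h.
  by case: (IH (false + acc)%N) => h _; apply: h.
by rewrite Tp; case: (IH (true + acc)%N) (IH (false + acc)%N) => _ -> [_ ->].
Qed.

Lemma exact_algorithmP (k : fieldType) (B : seq (bar m.+1)) : barcode k G B ->
  (query_cost phi G exact_algorithm <= m.+1 * n.+1 ^ 2)%N /\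
  forall P : pred R, P (statistic phi B) -> prob G P exact_algorithm = 1.
Proof.
move=> GB.
have [] := query_setTE _ (fun q => Query q.1 q.2.1 q.2.2)
  (fun q : 'I_m.+1 * ('I_n.+1 * 'I_n.+1) => G q.1 q.2.1 q.2.2) 1
  (fun S => Return _ _ (avg_interval R m phi (fun s t =>
    betti1 R n.+1 (fun u v =>
      [forall i : 'I_m.+1, (s <= i <= t)%N ==> ((i, (u, v)) \in S)])))).
  by move=> i k'; split=> //; rewrite add1n.
rewrite !card_prod !card_ord muln1 /= addn0 -mulnn => cst prb; split=> // P PB.
rewrite prb (_ : avg_interval _ _ _ _ = statistic phi B) ?PB //.
rewrite (statistic_avg _ _ _ _ _ _ _ GB); apply: eq_avg_interval => s t _.
congr betti1; apply/funext => u; apply/funext => v.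
by apply: eq_forallb => i; rewrite inE.
Qed.

End Semantics.
End Algorithms.

(** * Accuracy and cost of the sampling algorithm *)

(** For positive i, both [c <= N %/ i] and [i <= N %/ c] say that c i is at most [N], so exactly the
    first [N %/ c] thresholds are passed. *)
Lemma count_le_div N c : (0 < c)%N -> (\sum_(i < N) (c <= N %/ i.+1) = N %/ c)%N.
Proof.
move=> c0; have Nc : (N %/ c <= N)%N by apply: leq_div.
have -> : (\sum_(i < N) (c <= N %/ i.+1) = \sum_(i < N) (i < N %/ c))%N.
  by apply: eq_bigr => i _; rewrite leq_divRL // [in RHS]leq_divRL // mulnC.
rewrite -(big_mkord predT (fun i => nat_of_bool (i < N %/ c)%N)) /=.
rewrite (big_cat_nat (leq0n _) Nc) /= -[RHS]addn0; congr addn.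
  rewrite big_nat (eq_bigr (fun=> 1%N)); last by move=> i /andP[_ ->].
  by rewrite -big_nat sum_nat_const_nat subn0 muln1.
by rewrite big_nat big1 // => i /andP[ci _]; rewrite ltnNge ci.
Qed.

Section Analysis.
Variable R : realType.

Lemma harmonic_le_ln N : \sum_(i < N) i.+1%:R^-1 <= 1 + ln N%:R :> R.
Proof.
elim: N => [|[|N] IH]; first by rewrite big_ord0 ln0 // addr0.
  by rewrite big_ord1 ln1 invr1 addr0.
rewrite big_ord_recr /=; apply: le_trans (lerD IH (lexx _)) _.
rewrite -addrA lerD2l; set a : R := N.+1%:R; set b : R := N.+2%:R.
have a0 : 0 < a by rewrite ltr0n.
have ba : b = a + 1 by rewrite natr1.
have b0 : 0 < b by rewrite ltr0n.
(* The new term 1 / b is at most ln b - ln a, since 1 - 1 / b = a / b. *)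
have : ln (1 + - b^-1) <= - b^-1 by apply: le_ln1Dx; rewrite ltrN2 invf_lt1 // ba; lra.
have -> : 1 + - b^-1 = a / b by rewrite ba; field; lra.
by rewrite ln_div ?posrE // => ?; rewrite -lerBrDl -lerN2 opprB.
Qed.

Lemma sum_div_le N : \sum_(i < N) (N %/ i.+1)%:R <= N%:R * (1 + ln N%:R) :> R.
Proof.
apply: le_trans (ler_wpM2l (ler0n _ _) (harmonic_le_ln N)).
rewrite mulr_sumr; apply: ler_sum => i _.
by rewrite ler_pdivlMr ?ltr0n // -natrM ler_nat leq_trunc_div.
Qed.

Variables (n m : nat) (phi : weight R) (G : temporal_graph n.+1 m.+1).
Notation p := (edge_prob R n m phi G).
Notation qc := (component_prob R n m phi G).

Definition mean_inv_component : R := avg_interval R m phi (fun s t =>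
  \sum_v n.+1%:R^-1 * (#|connect (common n.+1 m.+1 G s t) v|%:R)^-1).

Lemma edge_prob01 : 0 <= p <= 1.
Proof. by case: (edge_testP R n m phi G). Qed.

Lemma component_prob01 c : 0 <= qc c <= 1.
Proof. by case: (component_testP R n m phi G c). Qed.

(** A vertex v passes [N %/ |C(v)|] of the thresholds; rounding down costs less than 1 per vertex,
    hence at most 1 on average. *)
Lemma component_mean N :
  `|\sum_(i < N) qc (N %/ i.+1) - N%:R * mean_inv_component| <= 1.
Proof.
pose C s t v := #|connect (common n.+1 m.+1 G s t) v|.
have C0 s t v : (0 < C s t v)%N by apply/card_gt0P; exists v; apply: connect0.
have -> : \sum_(i < N) qc (N %/ i.+1) =
    avg_interval R m phi (fun s t => \sum_v n.+1%:R^-1 * (N %/ C s t v)%:R).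
  rewrite -(avg_interval_sum R m phi _ _ (fun i s t => \sum_v n.+1%:R^-1 * _)).
  apply: eq_avg_interval => s t _; rewrite exchange_big /=; apply: eq_bigr => v _.
  by rewrite -mulr_sumr -natr_sum (count_le_div N _ (C0 s t v)).
rewrite /mean_inv_component -avg_intervalZ ler_norml.
apply/andP; split.
  rewrite lerBrDr addrC -[- 1](avg_interval_cst R m phi) -avg_intervalD.
  apply: le_avg_interval => s t _; rewrite -[X in _ + X](uniform_cst R n) mulr_sumr -big_split /=.
  apply: ler_sum => v _; rewrite mulrCA -mulrDr ler_wpM2l ?invr_ge0 //.
  have c0 : 0 < (C s t v)%:R :> R by rewrite ltr0n.
  rewrite lerBlDr natr1 ler_pdivrMr // -natrM ler_nat.
  by rewrite ltnW // ltn_ceil.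
rewrite lerBlDr -[X in _ <= X + _](avg_interval_cst R m phi) -avg_intervalD.
apply: le_avg_interval => s t _; rewrite -[X in X + _](uniform_cst R n) mulr_sumr -big_split /=.
apply: ler_sum => v _; rewrite [X in _ + X]mulrCA -mulrDr ler_wpM2l ?invr_ge0 //.
have c0 : 0 < (C s t v)%:R :> R by rewrite ltr0n.
rewrite -lerBlDl; apply: (@le_trans _ _ (N %/ C s t v)%:R); first lra.
by rewrite ler_pdivlMr // -natrM ler_nat leq_trunc_div.
Qed.

Lemma statistic_edge_component (k : fieldType) (B : seq (bar m.+1)) : barcode k G B ->
  statistic phi B =
  n.+1%:R ^+ 2 / 2 * p - n.+1%:R + n.+1%:R * mean_inv_component.
Proof.
move=> GB; rewrite (statistic_avg _ _ _ _ _ _ _ GB).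
rewrite -[X in _ - X](avg_interval_cst R m phi) -mulN1r -!avg_intervalZ -!avg_intervalD.
apply: eq_avg_interval => s t _; rewrite /betti1 mulN1r.
have n0 : n.+1%:R != 0 :> R by rewrite pnatr_eq0.
congr (_ - _ + _); last first.
  by rewrite mulr_sumr; apply: eq_bigr => v _; rewrite mulrA divff ?mul1r.
rewrite mulr_suml mulr_sumr; apply: eq_bigr => u _.
by rewrite -[\sum_v _^-1 * _]mulr_sumr; field; rewrite nat1r.
Qed.

Lemma sampling_cost Ne Nc :
  (query_cost phi G (sampling_algorithm R n m Ne Nc))%:R <=
  m.+1%:R * (Ne%:R + n.+1%:R * (Nc%:R * (1 + ln Nc%:R))) :> R.
Proof.
have [H _] := count_testsP R n m phi G Nc (fun c => component_test R n m (Nc %/ c)) 0 _ _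
  (fun c => component_testP R n m phi G (Nc %/ c)).
have [H' _] := count_testsP R n m phi G Ne (fun=> edge_test R n m) 0 _ _
  (fun=> edge_testP R n m phi G).
set d := (\sum_(i < Nc) (Nc %/ i.+1) * (n.+1 * m.+1))%N in H *.
apply: (@le_trans _ _ (\sum_(i < Ne) m.+1 + d)%N%:R).
  rewrite ler_nat; apply: H' => a.
  by rewrite -(addn0 d); apply: H => b.
rewrite natrD sum_nat_const card_ord natrM mulrDr mulrC lerD2l /d -big_distrl /= natrM.
rewrite mulrC natrM mulrA [m.+1%:R * _]mulrC -!mulrA natr_sum.
by rewrite ler_wpM2l // ler_wpM2l // sum_div_le.
Qed.

(** Edges and components each receive half of the error [eps * n.+1] and half of the failure
    probability. *)
Lemma sampling_prob (k : fieldType) (B : seq (bar m.+1)) (eps delta K : R) Ne Nc :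
  barcode k G B -> statistic phi B <= K -> 0 < eps <= 4^-1 -> 0 < delta < 1 ->
  16 * (K + n.+1%:R) / eps ^+ 2 * ln (4 / delta) <= Ne%:R ->
  128 / eps ^+ 2 * ln (4 / delta) <= Nc%:R ->
  4 / eps <= Nc%:R ->
  (0 < Ne)%N -> 0 <= K ->
  1 - delta <= output_prob phi G (fun F => `|F - statistic phi B| <= eps * n.+1%:R)
    (sampling_algorithm R n m Ne Nc).
Proof.
move=> GB FK /andP[e0 e4] /andP[d0 d1] hNe hNc hNc4 Ne0 K0.
rewrite (statistic_edge_component k B GB); rewrite (statistic_edge_component k B GB) in FK.
set q := mean_inv_component in FK *; set nn : R := n.+1%:R in hNe FK *.
have n1 : 1 <= nn by rewrite ler1n.
have nn0 : 0 < nn by lra.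
have q0 : 0 <= q.
  rewrite -(avg_interval_cst R m phi 0); apply: le_avg_interval => s t _.
  by apply: sumr_ge0 => v _; rewrite mulr_ge0 ?invr_ge0.
have Nc0 : 0 < Nc%:R :> R by apply: lt_le_trans hNc4; rewrite divr_gt0.
have Ne0' : 0 < Ne%:R :> R by rewrite ltr0n.
set D := ln (4 / delta) in hNe hNc.
have expD : expR (- D) = delta / 4.
  by rewrite expRN lnK ?posrE ?divr_gt0 // invf_div.
have half1 (z : R) : z <= delta / 2 -> 1 - delta <= 1 - delta / 2 + (-1) * z by lra.
have half2 (x z : R) : z <= delta / 2 -> 1 - delta / 2 + (-1) * x <= 1 - x + (-1) * z.
  by lra.
have /andP[p0 p1] := edge_prob01.
have [_ Pe] := count_testsP R n m phi G Ne (fun=> edge_test R n m) 0 _ _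
  (fun=> edge_testP R n m phi G).
have [_ Pc] := count_testsP R n m phi G Nc (fun c => component_test R n m (Nc %/ c)) 0 _ _
  (fun c => component_testP R n m phi G (Nc %/ c)).
rewrite {}Pe; under [X in _ <= bernoulli_sum _ _ _ _ X]funext do rewrite Pc /=.
set mue := \sum_(i < Ne) p; set muc := \sum_(i < Nc) qc (Nc %/ i.+1).
(* After rescaling, [te] is an error of [eps * nn / 2] and [tc] one of [eps * nn / 4]; the remaining
   quarter absorbs the rounding bias 1, as [4 / eps <= Nc]. *)
set te := eps * Ne%:R / nn; set tc := eps / 4 * Nc%:R.
have mueE : mue = Ne%:R * p by rewrite /mue sumr_const card_ord mulr_natl.
have be : bernoulli_sum R (fun=> p) Ne 0 (fun a => (te <= `|a%:R - mue|)%R%:R) <= delta / 2.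
  (* The bound on the mean comes from [nn ^+ 2 / 2 * p = F + nn - nn * q <= K + nn], where F is the
     statistic. *)
  have := chernoff R (fun=> p) Ne te (Ne%:R * (2 * (K + nn) / nn ^+ 2)).
  rewrite -/mue => h; apply: le_trans (h _ _ _ _) _ => {h}.
  - by move=> _; rewrite p0 p1.
  - rewrite mueE ler_pM2l // ler_pdivlMr ?exprn_gt0 //.
    by have := mulr_ge0 (le_trans ler01 n1) q0; lra.
  - by rewrite /te divr_gt0 ?mulr_gt0.
  - rewrite /te ler_pdivrMr //.
    rewrite (_ : _ * nn = Ne%:R * (4 * (K + nn) / nn)); last by field; lra.
    rewrite mulrC ler_pM2l // ler_pdivlMr //; nra.
  have -> : delta / 2 = 2 * expR (- D) by rewrite expD; field.
  rewrite ler_pM2l // ler_expR lerN2.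
  rewrite (_ : te ^+ 2 / _ = Ne%:R * eps ^+ 2 / (16 * (K + nn))); last first.
    by rewrite /te; field; lra.
  rewrite ler_pdivlMr; last lra.
  rewrite -ler_pdivrMr ?exprn_gt0 //; apply: le_trans _ hNe.
  by rewrite -/D le_eqVlt; apply/orP; left; apply/eqP; ring.
have bc : bernoulli_sum R (fun c => qc (Nc %/ c)) Nc 0
    (fun a => (tc <= `|a%:R - muc|)%R%:R) <= delta / 2.
  have := chernoff R (fun c => qc (Nc %/ c)) Nc tc Nc%:R.
  rewrite -/muc => h; apply: le_trans (h _ _ _ _) _ => {h}.
  - by move=> i; apply: component_prob01.
  - rewrite -[leRHS]mulr1 mulr_natl -[X in _ *+ X]card_ord -sumr_const.
    by apply: ler_sum => i _; case/andP: (component_prob01 (Nc %/ i.+1)).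
  - by rewrite /tc mulr_gt0 ?divr_gt0.
  - by rewrite /tc ler_pM2r //; lra.
  have -> : delta / 2 = 2 * expR (- D) by rewrite expD; field.
  rewrite ler_pM2l // ler_expR lerN2.
  rewrite (_ : tc ^+ 2 / _ = Nc%:R * eps ^+ 2 / 128); last by rewrite /tc; field; lra.
  rewrite ler_pdivlMr // -ler_pdivrMr ?exprn_gt0 //; apply: le_trans _ hNc.
  by rewrite -/D le_eqVlt; apply/orP; left; apply/eqP; ring.
have cm := component_mean Nc; rewrite -/muc -/q in cm.
have good a b : ~~ (te <= `|a%:R - mue|) -> ~~ (tc <= `|b%:R - muc|) ->
    `|estimate R n Ne Nc a b - (nn ^+ 2 / 2 * p - nn + nn * q)| <= eps * nn.
  rewrite -!ltNge => ha hb.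
  have -> : estimate R n Ne Nc a b - (nn ^+ 2 / 2 * p - nn + nn * q) =
      nn ^+ 2 / (2 * Ne%:R) * (a%:R - mue) +
      nn / Nc%:R * ((b%:R - muc) + (muc - Nc%:R * q)).
    by rewrite /estimate -/nn mueE; field; lra.
  apply: le_trans (ler_normD _ _) _.
  rewrite [X in X + _ <= _]normrM [X in _ + X <= _]normrM.
  have c1 : 0 <= nn ^+ 2 / (2 * Ne%:R) by rewrite divr_ge0 ?sqr_ge0 ?mulr_ge0.
  have c2 : 0 <= nn / Nc%:R by rewrite divr_ge0 // ltW.
  rewrite (ger0_norm c1) (ger0_norm c2).
  have -> : eps * nn = nn ^+ 2 / (2 * Ne%:R) * te +
      nn / Nc%:R * (eps / 2 * Nc%:R) by rewrite /te; field; lra.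
  apply: lerD; first by rewrite ler_wpM2l // ltW.
  rewrite ler_wpM2l //.
  apply: le_trans (ler_normD _ _) _.
  move: hNc4; rewrite ler_pdivrMr // /tc in hb * => hNc4; nra.
set Pc' := fun c => qc (Nc %/ c) in bc *.
pose E := fun a : nat => (te <= `|a%:R - mue|)%R%:R : R.
have p01 (i : nat) : 0 <= p <= 1 by rewrite p0 p1.
have q01 (i : nat) : 0 <= Pc' i <= 1 by apply: component_prob01.
(* Union bound, one expectation at a time: success is at least 1 minus the two failure indicators,
   the inner one being averaged first. *)
apply: (@le_trans _ _ (bernoulli_sum R (fun=> p) Ne 0 (fun a => (1 - delta / 2) + (-1) * E a))).
  by rewrite bernoulli_sumD bernoulli_sumZ bernoulli_sum_cst; apply: half1.
apply: le_bernoulli_sum => // a.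
apply: (@le_trans _ _ (bernoulli_sum R Pc' Nc 0 (fun b => (1 - E a) +
    (-1) * (tc <= `|b%:R - muc|)%R%:R))).
  by rewrite bernoulli_sumD bernoulli_sumZ bernoulli_sum_cst; apply: half2.
apply: le_bernoulli_sum => // b; rewrite /E.
have [_|ha] := boolP (te <= _).
  by rewrite subrr add0r mulN1r; apply: le_trans (ler0n _ _); rewrite oppr_le0.
have [_|hb] := boolP (tc <= _); first by rewrite subr0 mulr1 subrr.
by rewrite good //= subr0 mulr0 addr0.
Qed.

End Analysis.

(** * Sample sizes, their cost, and the choice of the algorithm *)

Lemma weight_fun_ge0 (R : realType) (phi : weight R) (x : R) : 0 <= x -> 0 <= weight_fun phi x.
Proof.
by move=> x0; apply: sumr_ge0 => r _; rewrite mulr_ge0 ?rv_law_ge0 ?exprn_ge0.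
Qed.

Section SampleSizes.
Variables (R : realType) (n : nat) (eps delta K : R).

(** The successor of the truncation exceeds the real bound and is positive. In [ln (4 / delta)], one
    factor 2 comes from the two tails and another from sharing [delta] between the two estimates. *)
Definition edge_samples : nat :=
  (Num.truncn (16 * (K + n%:R) / eps ^+ 2 * ln (4 / delta))).+1.

Definition component_samples : nat :=
  (Num.truncn (128 / eps ^+ 2 * ln (4 / delta))).+1.

Lemma inv_sqr_eps_ge : 0 < eps -> eps <= 4^-1 -> 16 <= (eps ^+ 2)^-1.
Proof.
move=> e0 e4; rewrite -[16]invrK lef_pV2 ?posrE ?invr_gt0 ?exprn_gt0 //.
have : eps * eps <= 4^-1 * 4^-1 by apply: ler_pM => //; apply: ltW.
by rewrite expr2; lra.
Qed.

Lemma ln_inv_delta_ge1 : 0 < delta -> delta < 3^-1 -> 1 <= ln (4 / delta).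
Proof.
move=> d0 d3; rewrite -ler_expR lnK ?posrE ?divr_gt0 //.
have h : expR (2^-1) <= 2 :> R.
  by apply: le_trans (expR_le_quadratic _ 2^-1 _) _; rewrite ?ger0_norm //; lra.
have -> : expR 1 = expR 2^-1 * expR 2^-1 :> R by rewrite -expRD; congr expR; lra.
apply: (@le_trans _ _ (2 * 2)).
  by rewrite ler_pM ?expR_ge0.
by rewrite ler_pdivlMr //; lra.
Qed.

Lemma component_samples_ge : 0 < eps -> eps <= 4^-1 -> 0 < delta -> delta < 3^-1 ->
  4 / eps <= component_samples%:R.
Proof.
move=> e0 e4 d0 d3; have D1 := ln_inv_delta_ge1 d0 d3.
have := truncnS_gt (128 / eps ^+ 2 * ln (4 / delta)) => /ltW; apply: le_trans.
apply: (@le_trans _ _ (128 / eps ^+ 2)); last by rewrite ler_peMr // mulr_ge0 // invr_ge0 sqr_ge0.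
rewrite ler_pdivrMr // mulrAC ler_pdivlMr ?exprn_gt0 //; nra.
Qed.

(** One power of the polylogarithm pays for [ln (4 / delta)], the other for the harmonic factor
    [1 + ln component_samples]. *)
Lemma samples_cost (m : nat) : (0 < n)%N -> (0 < m)%N -> 0 <= K ->
  0 < eps -> eps <= 4^-1 -> 0 < delta -> delta < 3^-1 ->
  m%:R * (edge_samples%:R + n%:R * (component_samples%:R * (1 + ln component_samples%:R))) <=
  (400 * 400) * (m%:R * ((K + n%:R) / eps ^+ 2)) * polylog 2 n m eps delta.
Proof.
move=> n0 m0 K0 e0 e4 d0 d3; rewrite /polylog;
have D1 := ln_inv_delta_ge1 d0 d3; have x16 := inv_sqr_eps_ge e0 e4.
set D := ln (4 / delta) in D1; set x := (eps ^+ 2)^-1 in x16 *; set P := 1 + _ + _ + _ + _.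
have n1 : 1 <= n%:R :> R by rewrite ler1n.
have ln_n : 0 <= ln n%:R :> R by rewrite ln_ge0.
have ln_m : 0 <= ln m%:R :> R by rewrite ln_ge0 // ler1n.
have ln_e : 0 <= ln eps^-1.
  by rewrite ln_ge0 // invf_ge1 //; lra.
have ln_d : 0 <= ln delta^-1.
  by rewrite ln_ge0 // invf_ge1 //; lra.
have ln4 : ln 4 <= 3 :> R.
  by rewrite (_ : 4 = 1 + 3) ?le_ln1Dx //; lra.
have P1 : 1 <= P by rewrite /P; lra.
have DP : D <= 3 * P.
  by rewrite /D lnM ?posrE ?invr_gt0 // /P; lra.
have [D0 P0 x0] : [/\ 0 <= D, 0 <= P & 0 <= x] by split; move: D1 x16; lra.
have xP : 1 <= x * P by apply: mulr_ege1 => //; move: x16; lra.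
have kn1 : 1 <= K + n%:R by lra.
(* 49 = 3 * 16 + 1, by [D <= 3 * P] and rounding; likewise 385 = 3 * 128 + 1 below. *)
have Ne_le : edge_samples%:R <= 49 * ((K + n%:R) * (x * P)).
  rewrite /edge_samples -natr1 -/D -/x.
  apply: (@le_trans _ _ (16 * (K + n%:R) * x * D + 1)).
    by rewrite lerD2r truncn_le !mulr_ge0 //; lra.
  have h1 : (K + n%:R) * (x * D) <= (K + n%:R) * (x * (3 * P)).
    by rewrite !ler_wpM2l //; lra.
  have h2 : 1 <= (K + n%:R) * (x * P) by apply: mulr_ege1.
  move: h1 h2; lra.
have Nc_le : component_samples%:R <= 385 * (x * P).
  rewrite /component_samples -natr1 -/D -/x.
  apply: (@le_trans _ _ (128 * x * D + 1)).
    by rewrite lerD2r truncn_le !mulr_ge0.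
  have h1 : x * D <= x * (3 * P) by rewrite ler_wpM2l.
  move: h1 xP; lra.
have lnx : ln x = 2 * ln eps^-1 by rewrite /x -exprVn lnXn ?invr_gt0 // mulr_natl.
have lnP : ln P <= P by rewrite ltW // ln_sublinear //; lra.
have ln385 : ln 385 <= 384 :> R.
  by rewrite (_ : 385 = 1 + 384) ?le_ln1Dx //; lra.
(* 388 collects 1, the bound 384 on ln 385, 2 from [ln x], and 1 from [ln P <= P]. *)
have lnNc : 1 + ln component_samples%:R <= 388 * P.
  have : ln component_samples%:R <= ln (385 * (x * P)).
    by rewrite ler_ln ?posrE ?ltr0n //; lra.
  rewrite !lnM ?posrE ?lnx //; try lra.
  rewrite /P in P1 lnP *; lra.
have Nc_cost : component_samples%:R * (1 + ln component_samples%:R) <= 385 * (x * P) * (388 * P).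
  by apply: ler_pM => //; rewrite addr_ge0 // ln_ge0 // ler1n.
have -> : (400 * 400) * (m%:R * ((K + n%:R) / eps ^+ 2)) * P ^+ 2 =
    m%:R * ((400 * 400) * ((K + n%:R) * (x * P) * P)) by rewrite /x; field; lra.
rewrite ler_wpM2l //.
have c1 : (K + n%:R) * (x * P) <= (K + n%:R) * (x * P) * P.
  by rewrite ler_peMr // !mulr_ge0 //; lra.
have c2 : n%:R * (component_samples%:R * (1 + ln component_samples%:R)) <=
    (K + n%:R) * (385 * (x * P) * (388 * P)).
  apply: ler_pM => //; last lra.
  by rewrite mulr_ge0 // addr_ge0 // ln_ge0 // ler1n.
move: Ne_le c1 c2; set a := (K + n%:R) * (x * P).
rewrite (_ : (K + n%:R) * (385 * _ * _) = 385 * (388 * (a * P))); last by rewrite /a; ring.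
rewrite -/(a * P) -[400 * 400 * _]mulrA.
have : 0 <= a * P by rewrite !mulr_ge0 //; lra.
move: (a * P) => y y0 Ne_le ay nc.
have h1 : 385 * (388 * y) <= 385 * (400 * y) by rewrite ler_wpM2l //; lra.
have h2 : 49 * a <= 400 * y by lra.
apply: le_trans (lerD (le_trans Ne_le h2) (le_trans nc h1)) _.
have : 0 <= 400 * y by rewrite mulr_ge0.
move: (400 * y) => w; lra.
Qed.
End SampleSizes.

(** The subroutines draw from nonempty ranges and take the predecessors of [n] and [m]; the value 0
    fills the empty cases. *)
Definition snapshot_algorithm (R : realType) (n m : nat) (phi : weight R) (eps delta K : R) :
    algorithm R n m :=
  match n, m with
  | n'.+1, m'.+1 =>
    if n'.+1%:R ^+ 2 <= (K + n'.+1%:R) / eps ^+ 2 then exact_algorithm R n' m' phi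
    else sampling_algorithm R n' m' (edge_samples R n'.+1 eps delta K)
           (component_samples R eps delta)
  | _, _ => Return _ _ 0
  end.

Theorem theorem4p3 (R : realType) :
  exists (C : R) (c : nat), 0 < C /\
  forall k : fieldType,
  exists A : forall (n m : nat) (phi : weight R) (eps delta K : R), algorithm R n m,
  forall (n m : nat) (phi : weight R) (eps delta K : R),
    (0 < n)%N -> (0 < m)%N ->
    n%:R^-1 <= eps <= 4%:R^-1 -> 0 < delta < 3%:R^-1 ->
  forall (G : temporal_graph n m) (B : seq (bar m)),
    barcode k G B -> statistic phi B <= K ->
    (query_cost phi G (A n m phi eps delta K))%:R <=
      C * (m%:R * Num.min (n%:R ^+ 2) ((K + n%:R) / eps ^+ 2))
        * polylog c n m eps delta
    /\
    1 - delta <=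
      output_prob phi G (fun Fhat => `|Fhat - statistic phi B| <= eps * n%:R)
        (A n m phi eps delta K).
Proof.
exists (400 * 400), 2%N; split=> [|k]; first by rewrite mulr_gt0.
exists (snapshot_algorithm R) => -[|n] [|m] // phi eps delta K n0 m0.
move=> /andP[en e4] /andP[d0 d3] G B GB FK.
have e0 : 0 < eps by apply: lt_le_trans en; rewrite invr_gt0 ltr0n.
have K0 : 0 <= K.
  apply: le_trans FK; apply: sumr_ge0 => b _; apply: weight_fun_ge0.
  by rewrite divr_ge0.
have polylog_ge1 : 1 <= polylog 2 n.+1 m.+1 eps delta.
  rewrite /polylog exprn_ege1 // -!addrA lerDl !addr_ge0 ?ln_ge0 ?ler1n //.
    by rewrite invf_ge1 //; lra.
  by rewrite invf_ge1 //; lra.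
have d1 : 0 < delta < 1 by apply/andP; split=> //; lra.
(* The comparison made by the algorithm also evaluates the minimum in the bound. *)
rewrite /snapshot_algorithm; have [small|large] := leP (n.+1%:R ^+ 2) ((K + n.+1%:R) / eps ^+ 2).
  have [cost prob] := exact_algorithmP R n m phi G k B GB; split.
    apply: (@le_trans _ _ (m.+1%:R * n.+1%:R ^+ 2)).
      by rewrite -natrX -natrM ler_nat.
    apply: (@le_trans _ _ (400 * 400 * (m.+1%:R * n.+1%:R ^+ 2))).
      rewrite ler_peMl ?mulr_ge0 ?sqr_ge0 // mulr_ege1 // ler1n //.
    by rewrite ler_peMr // !mulr_ge0 ?sqr_ge0.
  rewrite prob; first lra.
  by rewrite subrr normr0 mulr_ge0 // ltW.
split.
  apply: le_trans (sampling_cost R n m phi G _ _) _.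
  exact: samples_cost.
apply: (sampling_prob R n m phi G k B eps delta K) => //.
- by rewrite e0.
- exact/ltW/truncnS_gt.
- exact/ltW/truncnS_gt.
- exact: component_samples_ge.
Qed.
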